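(* Let $I\subset\mathbb{Z}^d$ be a nonempty finite set, let $V=V(I)=\operatorname{span}_{\mathbb{C}}\{\exp(2\pi\mathrm i\langle\bm k,\cdot\rangle) : \bm k\in I\}$ be the corresponding space of trigonometric polynomials on $\mathbb{T}^d$, and let $\mathcal{D}(I)=\{\bm k-\bm\ell : \bm k,\bm\ell\in I\}$. Then, with $N=|\mathcal{D}(I)|\le|I|^2-|I|+1$, there exist points $\bm x^1,\dots,\bm x^N\in\mathbb{T}^d$ and non-negative weights $w_1,\dots,w_N$ satisfying $w_1+\dots+w_N=1$ such that for all $f\in V$ $$\int_{\mathbb{T}^d}|f(\bm x)|^2\,\mathrm d\bm x=\sum_{i=1}^N w_i|f(\bm x^i)|^2 .$$
   Context: $\mathbb{T}=[0,1)$ is the torus with endpoints identified; $\mathbb{T}^d$ is the $d$-dimensional torus with normalized Lebesgue measure $\mathrm d\bm x$. *)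

(* Defs.v *)
From HB Require Import structures.
From mathcomp Require Import all_boot all_order all_algebra finmap.
From mathcomp Require Import complex.
From mathcomp Require Import all_classical all_reals all_analysis.

Set Implicit Arguments.
Unset Strict Implicit.
Unset Printing Implicit Defensive.

Import Order.TTheory GRing.Theory Num.Theory.
Import numFieldNormedType.Exports.

Local Open Scope classical_set_scope.
Local Open Scope fset_scope.
Local Open Scope complex_scope.
Local Open Scope ring_scope.

(* T^d is represented by the fundamental domain [0,1)^d of R^d / Z^d, and
   functions on T^d by 1-periodic functions on R^d. *)
Definition torus (R : realType) (d : nat) : set (d.-tuple R) :=
  [set x | forall j, tnth x j \in `[0, 1[].

Arguments torus R d : clear implicits.

Section torus_measure.
Context {R : realType}.
Local Open Scope ereal_scope.

Lemma measurable_itv01 : measurable (`[0%R, 1%R[%classic : set R).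
Proof. exact: measurable_itv. Qed.

Definition lebesgue01 : set R -> \bar R :=
  mrestr (@lebesgue_measure R) measurable_itv01.

Let lebesgue01_measure := mrestr (@lebesgue_measure R) measurable_itv01.

Let lebesgue01_0 : lebesgue01 set0 = 0.
Proof. exact: (measure0 lebesgue01_measure). Qed.

Let lebesgue01_ge0 A : 0 <= lebesgue01 A.
Proof. exact: (measure_ge0 lebesgue01_measure). Qed.

Let lebesgue01_sigma_additive : semi_sigma_additive lebesgue01.
Proof. exact: (@measure_semi_sigma_additive _ _ _ lebesgue01_measure). Qed.

HB.instance Definition _ := isMeasure.Build _ _ _ lebesgue01
  lebesgue01_0 lebesgue01_ge0 lebesgue01_sigma_additive.

Lemma lebesgue01_setT : lebesgue01 [set: R] = 1.
Proof.
rewrite /lebesgue01 /mrestr setTI lebesgue_measure_itv /=.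
by rewrite lte_fin ltr01 oppr0 adde0.
Qed.

HB.instance Definition _ :=
  Measure_isProbability.Build _ _ _ lebesgue01 lebesgue01_setT.

Definition tuple_cons (d : nat) (xs : R * d.-tuple R) : d.+1.-tuple R :=
  [tuple of xs.1 :: xs.2].

Lemma measurable_tuple_cons (d : nat) :
  measurable_fun [set: R * d.-tuple R] (@tuple_cons d).
Proof. exact: measurable_cons. Qed.

HB.instance Definition _ (d : nat) :=
  @isMeasurableFun.Build _ _ _ _ (@tuple_cons d) (@measurable_tuple_cons d).

End torus_measure.

(* The d-fold product of the Lebesgue measure on [0,1); [distribution] is the
   push-forward along R * R^d -> R^(d+1). *)
Fixpoint torus_measure (R : realType) (d : nat) : probability (d.-tuple R) R :=
  match d with
  | 0 => @dirac _ (0.-tuple R) [tuple] R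
  | d'.+1 => distribution (lebesgue01 \x torus_measure R d')%E (@tuple_cons R d')
  end.

Lemma torus_measure_box (R : realType) (d : nat) (A : 'I_d -> set R) :
  (forall j, measurable (A j)) ->
  torus_measure R d [set x | forall j, A j (tnth x j)] =
  (\prod_(j < d) lebesgue01 (A j))%E.
Proof.
elim: d A => [|d IHd] A mA.
  by rewrite big_ord0 /= diracE mem_set//=; case.
have mB : measurable [set x : d.-tuple R | forall j, A (lift ord0 j) (tnth x j)].
  rewrite [X in measurable X](_ : _ = \bigcap_(j in [set: 'I_d])
      ((fun x : d.-tuple R => tnth x j) @^-1` A (lift ord0 j))); last first.
    by apply/seteqP; split => x /= h j; [move=> _|]; exact: h.
  apply: fin_bigcap_measurable; first exact: finite_finset.
  by move=> j _; rewrite -[X in measurable X]setTI; exact: measurable_tnth.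
rewrite big_ord_recl -IHd// /= /distribution /pushforward -product_measure1E//=.
congr (_ \x _)%E; apply/seteqP; split => -[a x] /=.
- move=> h; split; first exact: (h ord0).
  by move=> j; have := h (lift ord0 j); rewrite tnthS.
- move=> [h0 h] j; case: (unliftP ord0 j) => [k ->|->]; last exact: h0.
  by rewrite tnthS; exact: h.
Qed.

(* exp(2 pi i <k, x>) *)
Definition fourier_char (R : realType) (d : nat) (k : 'rV[int]_d)
    (x : d.-tuple R) : R[i] :=
  let t := 2 * pi * \sum_(j < d) (k ord0 j)%:~R * tnth x j in
  cos t +i* sin t.

Definition trig_poly (R : realType) (d : nat) (I : {fset 'rV[int]_d}) :
    set (d.-tuple R -> R[i]) :=
  [set f | exists c : 'rV[int]_d -> R[i],
     forall x, f x = \sum_(k <- I) c k * fourier_char k x].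

Definition diff_set (d : nat) (I : {fset 'rV[int]_d}) : {fset 'rV[int]_d} :=
  [fset k - l | k in I, l in I].

(* Main.v *)
From HB Require Import structures.
Require Import Defs.
From mathcomp Require Import all_boot all_order all_algebra finmap.
From mathcomp Require Import complex ring lra.
From mathcomp Require Import all_classical all_reals all_analysis.
From mathcomp Require Import measurable_realfun.

Set Implicit Arguments.
Unset Strict Implicit.
Unset Printing Implicit Defensive.

Import Order.TTheory GRing.Theory Num.Theory.
Import numFieldNormedType.Exports.

Local Open Scope classical_set_scope.
Local Open Scope fset_scope.
Local Open Scope ring_scope.

(** The integral of [|f|^2] is a linear combination of integrals of
    [cos (2 pi <m, x> + a)] with [m] in the difference set [D]. The uniform average
    over a grid fine enough to separate the elements of [D] from 0 integrates all of
    them exactly, and Caratheodory's theorem in dimension [|D|] selects [|D|] points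
    of the grid. *)

(** * The difference set: size, zero and symmetry *)

(** All diagonal pairs have the same difference 0, so the set is covered by 0 and the differences of
    the [|I|^2 - |I|] off-diagonal pairs. *)
Lemma card_diff_set (d : nat) (I : {fset 'rV[int]_d}) :
  (#|` diff_set I| <= #|` I| ^ 2 - #|` I| + 1)%N.
Proof.
pose diag := [set (k, k) | k : I]%SET.
have card_off : #|~: diag| = (#|` I| ^ 2 - #|` I|)%N.
  rewrite cardsCs finset.setCK card_prod card_imset -?cardfE ?mulnn//.
  by move=> k l [].
rewrite -card_off addn1 cardE -(size_map (fun p => val p.1 - val p.2)).
rewrite -[X in (_ <= X)%N]/(size (0 :: _)).
apply: uniq_leq_size => // m /imfset2P[k /= kI [l /= lI ->]].
rewrite inE; have [->|kl] := eqVneq k l; first by rewrite subrr eqxx.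
apply/orP; right; apply/mapP; exists ([` kI], [` lI]) => //=.
rewrite mem_enum inE; apply: contra kl.
by move=> /imsetP[x _ [<- /(congr1 val)/= ->]].
Qed.

Lemma diff_set0 (d : nat) (I : {fset 'rV[int]_d}) :
  I != fset0 -> 0 \in diff_set I.
Proof.
move=> /fset0Pn[k kI]; apply/imfset2P.
by exists k => //; exists k => //; rewrite subrr.
Qed.

Lemma diff_setN (d : nat) (I : {fset 'rV[int]_d}) (m : 'rV[int]_d) :
  m \in diff_set I -> - m \in diff_set I.
Proof.
move=> /imfset2P[k /= kI [l /= lI ->]]; apply/imfset2P.
by exists l => //; exists k => //; rewrite opprB.
Qed.

(** * Caratheodory's theorem for cones *)

Lemma linear_dependence (F : fieldType) (m n : nat) (g : 'I_n -> 'rV[F]_m) :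
  (m < n)%N -> exists2 c : 'I_n -> F,
    exists j, c j != 0 & \sum_j c j *: g j = 0.
Proof.
move=> mn; pose A := \matrix_(i < n) g i.
have : kermx A != 0.
  rewrite kermx_eq0 /row_free neq_ltn (leq_ltn_trans _ mn)//.
  exact: rank_leq_col.
move=> /matrix0Pn[i [j kij]]; exists (kermx A i); first by exists j.
have /matrixP kA := mulmx_ker A.
apply/rowP => k; rewrite summxE [RHS]mxE; have := kA i k.
rewrite [RHS]mxE mxE => kAik; rewrite -[RHS]kAik.
by apply: eq_bigr => l _; rewrite !mxE.
Qed.

(* Subtracting from the weights a multiple of a linear relation, as large as
   nonnegativity allows, kills one of them. *)
Lemma conic_caratheodory (R : realFieldType) (T : Type) (t0 : T) (m : nat)
    (g : T -> 'rV[R]_m) (n : nat) (p : 'I_n -> T) (w : 'I_n -> R) :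
  (forall i, 0 <= w i) ->
  exists (q : 'I_m -> T) (u : 'I_m -> R), (forall i, 0 <= u i) /\
    \sum_i u i *: g (q i) = \sum_i w i *: g (p i).
Proof.
elim: n p w => [|n IHn] p w w0.
  exists (fun=> t0), (fun=> 0); split=> //.
  by rewrite big_ord0 big1// => i _; rewrite scale0r.
have [nm|mn] := leqP n.+1 m.
  (* At most [m] points: the list is padded to length [m] with [t0] at weight 0. *)
  pose h (i : nat) : option 'I_n.+1 := insub i.
  pose v i := if h i is Some j then w j else 0.
  pose r i := if h i is Some j then p j else t0.
  exists r, v; split; first by move=> i; rewrite /v; case: (h i).
  transitivity (\sum_(i < n.+1) v i *: g (r i)).
    rewrite (big_ord_widen_cond m xpredT (fun i => v i *: g (r i)) nm) /=.
    rewrite [RHS]big_mkcond /=; apply: eq_bigr => i _.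
    by case: ifPn => // ni; rewrite /v /h insubN// scale0r.
  by apply: eq_bigr => i _; rewrite /v /r /h valK.
have [c0 [j0 cj0] c0g] := @linear_dependence R m n.+1 (g \o p) mn.
(* The minimal ratio below ranges over positive coefficients; changing the sign of the relation if
   necessary guarantees that there is one. *)
have [c [j cj cg]] : exists c : 'I_n.+1 -> R,
    exists2 j, 0 < c j & \sum_j c j *: g (p j) = 0.
  have [cp|cn|/esym/eqP] := ltrgtP 0 (c0 j0).
  - by exists c0, j0.
  - exists (\- c0), j0; first by rewrite oppr_gt0.
    by under eq_bigr do rewrite scaleNr; rewrite sumrN c0g oppr0.
  - by rewrite (negbTE cj0).
pose k := [arg min_(i < j | 0 < c i) (w i / c i)]%O.
have [ck kmin] : 0 < c k /\ forall i, 0 < c i -> w k / c k <= w i / c i.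
  by rewrite /k; case: Order.TotalTheory.arg_minP.
pose t := w k / c k; pose v i := w i - t * c i.
have v0 i : 0 <= v i.
  have [ci|ci] := ltP 0 (c i).
    by rewrite subr_ge0 -ler_pdivlMr// kmin.
  (* Where [c i <= 0], subtracting [t * c i] with [t >= 0] cannot lower the weight. *)
  rewrite subr_ge0 (le_trans _ (w0 i))// mulr_ge0_le0//.
  by rewrite divr_ge0// ltW.
have vk : v k = 0 by rewrite /v /t divfK ?subrr// gt_eqF.
have [q [u [u0 ug]]] := IHn (p \o lift k) (v \o lift k) (fun=> v0 _).
exists q, u; split=> //; rewrite {}ug.
transitivity (\sum_i v i *: g (p i)).
  by rewrite [RHS](bigD1_ord k)//= vk scale0r add0r.
rewrite /v; under eq_bigr do rewrite scalerBl -scalerA.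
by rewrite big_split /= sumrN -scaler_sumr cg scaler0 subr0.
Qed.

(** * Phases and integrals of cosines over one period *)

(** The angle [t] inside [fourier_char], kept separate so that integration and cubature deal with
    real cosines only. *)
Definition phase (R : realType) (d : nat) (m : 'rV[int]_d) (x : d.-tuple R) : R :=
  2 * pi * \sum_(j < d) (m ord0 j)%:~R * tnth x j.

Lemma cosD_2pi_int (R : realType) (n : int) (a : R) :
  cos (2 * pi * n%:~R + a) = cos a.
Proof.
have cosn (k : nat) (b : R) : cos (b + 2 * pi * k%:R) = cos b.
  by rewrite -[RHS](periodicn (@cosD2pi R) k) !mulr_natr mulrC mulr_natr.
case: n => k; first by rewrite addrC cosn.
by rewrite -[LHS](cosn k.+1) NegzE mulrNz; congr cos; ring.
Qed.

Lemma sinD_2pi_int (R : realType) (n : int) (a : R) :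
  sin (2 * pi * n%:~R + a) = sin a.
Proof. by rewrite -!cosBpihalf -addrA cosD_2pi_int. Qed.

Lemma measurable_cos_phase (R : realType) (d : nat) (m : 'rV[int]_d) (a : R) :
  measurable_fun [set: d.-tuple R] (fun x => cos (phase m x + a)).
Proof.
apply: (measurableT_comp (continuous_measurable_fun (@continuous_cos R))).
apply: measurable_funD; last exact: measurable_cst.
apply: measurable_funM; first exact: measurable_cst.
apply: measurable_sum => j; apply: measurable_funM; first exact: measurable_cst.
exact: measurable_tnth.
Qed.

Lemma bounded_cos (R : realType) (T : Type) (D : set T) (f : T -> R) :
  [bounded cos (f x) | x in D].
Proof.
exists 1; split; first exact: num_real.
move=> M M1 x _ /=; rewrite (le_trans _ (ltW M1))// ler_norml.
by rewrite cos_geN1 cos_le1.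
Qed.

Lemma probability_bounded_integrable (R : realType) (d : measure_display)
    (T : measurableType d) (mu : probability T R) (f : T -> R) :
  measurable_fun [set: T] f -> [bounded f x | x in [set: T]] ->
  mu.-integrable [set: T] (EFin \o f).
Proof.
move=> mf bf; apply: measurable_bounded_integrable => //.
exact: le_lt_trans (probability_le1 mu measurableT) (ltry 1).
Qed.

(* [lebesgue_measure] lives on [measurableTypeR R], whose display is not that of
   the canonical measurable type on [R], where [lebesgue01] lives: the push-forward
   along the identity relates the two. *)
Definition of_measurableTypeR (R : realType) : measurableTypeR R -> R := idfun.

HB.instance Definition _ (R : realType) :=
  @isMeasurableFun.Build _ _ _ _ (@of_measurableTypeR R)
    (@measurable_id _ _ setT).

(** Brings the integral to a closed interval, where the fundamental theorem of calculus applies. The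
    complement of [0,1) is null for [lebesgue01], and adding the endpoint 1 does not change a
    Lebesgue integral. *)
Lemma integral_lebesgue01E (R : realType) (f : R -> R) :
  measurable_fun [set: R] f -> [bounded f x | x in [set: R]] ->
  (\int[lebesgue01]_t (f t)%:E =
   \int[lebesgue_measure]_(t in `[0%R, 1%R]) (f t)%:E)%E.
Proof.
move=> mf bf.
pose D : set R := `[0%R, 1%R[%classic.
have mD : measurable D by exact: measurable_itv.
transitivity (\int[lebesgue01]_(t in D) (f t)%:E)%E.
  rewrite (@negligible_integral _ _ _ _ _ (~` D))//.
  - by rewrite setTD setCK.
  - exact: measurableC.
  - exact: probability_bounded_integrable.
  - by rewrite -[LHS]/(lebesgue_measure (~` D `&` D)) setICl measure0.
pose leb01 := mrestr (@lebesgue_measure R) mD.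
transitivity (\int[pushforward leb01 (@of_measurableTypeR R)]_(t in D)
    (f t)%:E)%E.
  exact: eq_measure_integral.
rewrite integral_pushforward//; last 2 first.
- exact/measurable_EFinP.
- apply: measurable_bounded_integrable => //; last 2 first.
  + exact: measurable_funTS.
  + by apply: filterS bf => M fM x _; exact: fM.
  rewrite -[X in (X < _)%E]/(lebesgue_measure (D `&` D)) setIid.
  by rewrite lebesgue_measure_itv /= lte_fin ltr01 oppr0 adde0 ltry.
transitivity (\int[@lebesgue_measure R]_(t in D) (f t)%:E)%E.
  apply: eq_measure_integral => A mA AD.
  by rewrite /leb01 /= /mrestr; congr lebesgue_measure; exact: setIidl.
rewrite integral_itv_bndo_bndc//; apply: measurable_funTS.
exact/measurable_EFinP.
Qed.

Lemma integral_lebesgue01_cos (R : realType) (n : int) (a : R) :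
  (\int[lebesgue01]_t (cos (2 * pi * n%:~R * t + a))%:E =
   ((n == 0)%:R * cos a)%:E)%E.
Proof.
have [->|n0] := eqVneq n 0.
  under eq_integral do rewrite mulr0 mul0r add0r.
  rewrite integral_cst// [X in (_ * X)%E](@lebesgue01_setT R).
  by rewrite mule1 mul1r.
rewrite mul0r.
pose c : R := 2 * pi * n%:~R.
have c0 : c != 0.
  by rewrite !mulf_neq0 ?pnatr_eq0 ?intr_eq0// gt_eqF// pi_gt0.
pose f t := cos (c * t + a).
pose F t := c^-1 * sin (c * t + a).
have dF (t : R) : is_derive t (1 : R) F (f t).
  have lin : is_derive t (1 : R) (fun t : R => c * t + a) c.
    by apply: is_derive_eq; rewrite addr0 scaler1.
  have := is_deriveZ c^-1 (@is_derive1_comp _ sin (fun t => c * t + a) t _ _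
    (is_derive_sin _) lin).
  by rewrite /GRing.scale/= mulrCA mulVf// mulr1.
have df (t : R) : is_derive t (1 : R) f (- c * sin (c * t + a)).
  have lin : is_derive t (1 : R) (fun t : R => c * t + a) c.
    by apply: is_derive_eq; rewrite addr0 scaler1.
  have -> : - c * sin (c * t + a) = - sin (c * t + a) * c by ring.
  exact: (@is_derive1_comp _ cos (fun t => c * t + a) t _ _
    (is_derive_cos _) lin).
have cont (h dh : R -> R) : (forall t : R, is_derive t (1 : R) h (dh t)) ->
    continuous h.
  move=> dh_ t; apply: differentiable_continuous.
  by have [? _] := dh_ t; exact/derivable1_diffP.
have cf := cont _ _ df.
have cF := cont _ _ dF.
have mf := continuous_measurable_fun cf.
rewrite integral_lebesgue01E//; last exact: bounded_cos.
rewrite (@continuous_FTC2 _ _ F)//.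
(* The antiderivative takes equal values at 0 and 1, since [c] is an integer multiple of the
   period. *)
- by rewrite /F mulr1 mulr0 add0r /c sinD_2pi_int -EFinB subrr.
- exact: continuous_subspaceT.
- split.
  + by move=> t _.
  + by apply: cvg_at_right_filter; exact: cF.
  + by apply: cvg_at_left_filter; exact: cF.
- by move=> t _; rewrite derive1E; exact: derive_val.
Qed.

(** * Integrals of cosines over the torus *)

Lemma phase_cons (R : realType) (d : nat) (m : 'rV[int]_d.+1) (t : R)
    (x : d.-tuple R) :
  phase m (tuple_cons (t, x)) =
  2 * pi * (m ord0 ord0)%:~R * t + phase (\row_j m ord0 (lift ord0 j)) x.
Proof.
rewrite /phase big_ord_recl mulrDr mulrA; congr (_ + _ * _).
by apply: eq_bigr => j _; rewrite mxE tnthS.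
Qed.

(** Induction on [d] by Fubini. The free shift [a] absorbs the phase of the remaining coordinates,
    so the inner integral is the one-dimensional one. *)
Lemma integral_torus_cos (R : realType) (d : nat) (m : 'rV[int]_d) (a : R) :
  (\int[torus_measure R d]_y (cos (phase m y + a))%:E =
   ((m == 0)%:R * cos a)%:E)%E.
Proof.
elim: d m a => [|d IHd] m a.
  rewrite integral_dirac//; last first.
    apply/measurable_EFinP; exact: measurable_cos_phase.
  by rewrite diracT mul1e /phase big_ord0 mulr0 add0r thinmx0 eqxx mul1r.
pose f := EFin \o (fun x : d.+1.-tuple R => cos (phase m x + a)).
have mf : measurable_fun [set: d.+1.-tuple R] f.
  by apply/measurable_EFinP; exact: measurable_cos_phase.
pose m' := \row_j m ord0 (lift ord0 j).
have if_ : (lebesgue01 \x torus_measure R d)%E.-integrable setT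
    (f \o @tuple_cons R d).
  apply: (@probability_bounded_integrable R _ _
    (lebesgue01 \x torus_measure R d)%E
    (fun z => cos (phase m (tuple_cons z) + a))); last exact: bounded_cos.
  apply: (measurableT_comp (f := fun y => cos (phase m y + a))).
    exact: measurable_cos_phase.
  exact: measurable_tuple_cons.
transitivity (\int[lebesgue01 \x torus_measure R d]_z (f \o @tuple_cons R d) z)%E.
  (* The measure in dimension [d.+1] is by definition a push-forward, so this is a change of
     variables. *)
  rewrite -[LHS]/(\int[pushforward (lebesgue01 \x torus_measure R d)%E
    (@tuple_cons R d)]_y f y)%E.
  by rewrite integral_pushforward.
rewrite -integral21_prod_meas1//.
transitivity (\int[torus_measure R d]_x
    ((m ord0 ord0 == 0)%:R%:E * (cos (phase m' x + a))%:E))%E.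
  apply: eq_integral => x _; rewrite /fubini_G /f /=.
  under eq_integral do rewrite phase_cons -addrA.
  by rewrite integral_lebesgue01_cos.
rewrite integralZl//; last first.
  apply: probability_bounded_integrable; last exact: bounded_cos.
  exact: measurable_cos_phase.
rewrite IHd -EFinM mulrA -natrM mulnb.
suff -> : (m == 0) = (m ord0 ord0 == 0) && (m' == 0) by [].
apply/idP/idP => [/eqP m0|/andP[/eqP m0 /eqP/rowP m'0]].
  rewrite /m' m0 mxE eqxx /=; apply/eqP/rowP => j.
  by rewrite !mxE.
apply/eqP/rowP => j; rewrite [RHS]mxE.
case: (unliftP ord0 j) => [k ->|->] //.
by have := m'0 k; rewrite !mxE.
Qed.

Lemma measurable_torus (R : realType) (d : nat) : measurable (torus R d).
Proof.
rewrite (_ : torus R d = \bigcap_(j in [set: 'I_d])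
    ((fun x : d.-tuple R => tnth x j) @^-1` `[0, 1[)); last first.
  by apply/seteqP; split => x /= h j; [move=> _|]; exact: h.
apply: fin_bigcap_measurable; first exact: finite_finset.
by move=> j _; rewrite -[X in measurable X]setTI; exact: measurable_tnth.
Qed.

Lemma torus_measure_torus (R : realType) (d : nat) :
  torus_measure R d (torus R d) = 1%E.
Proof.
rewrite (@torus_measure_box R d (fun=> `[0, 1[%classic)); last first.
  by move=> j; exact: measurable_itv.
apply: big1 => j _.
have := @lebesgue01_setT R; rewrite /lebesgue01 /mrestr setTI => <-.
by rewrite setIid.
Qed.

(** The box has full measure, so its complement is null. *)
Lemma integral_over_torus (R : realType) (d : nat) (f : d.-tuple R -> \bar R) :
  (torus_measure R d).-integrable setT f ->
  (\int[torus_measure R d]_(y in torus R d) f y =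
   \int[torus_measure R d]_y f y)%E.
Proof.
have mT := @measurable_torus R d.
have C0 : torus_measure R d (~` torus R d) = 0%E.
  by rewrite probability_setC// torus_measure_torus subee.
move=> intf; rewrite [RHS](@negligible_integral _ _ _ _ _ (~` torus R d))//.
- by rewrite setTD setCK.
- exact: measurableC.
Qed.

(** * Exactness of uniform grid averages *)

Definition grid_point (R : realType) (d M : nat) (q : {ffun 'I_d -> 'I_M}) :
  d.-tuple R := [tuple (q j)%:R / M%:R | j < d].

Lemma grid_point_torus (R : realType) (d M : nat) (q : {ffun 'I_d -> 'I_M}) :
  torus R d (grid_point R q).
Proof.
move=> j; rewrite tnth_mktuple in_itv /= divr_ge0//=.
have M0 : (0 < M)%N by case: (q j) => k; exact: leq_ltn_trans.
by rewrite ltr_pdivrMr ?ltr0n// mul1r ltr_nat.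
Qed.

(** This is exp(it). In complex form the grid sums factor over the coordinates and become
    geometric. *)
Definition expi (R : realType) (t : R) : R[i] := (cos t +i* sin t)%C.

Lemma expi0 (R : realType) : expi (0 : R) = 1.
Proof. by rewrite /expi cos0 sin0. Qed.

Lemma expiD (R : realType) (s t : R) : expi (s + t) = expi s * expi t.
Proof. by rewrite /expi cosD sinD; congr (_ +i* _)%C; rewrite addrC. Qed.

Lemma expi_sum (R : realType) (J : Type) (r : seq J) (t : J -> R) :
  expi (\sum_(j <- r) t j) = \prod_(j <- r) expi (t j).
Proof. exact: (big_morph _ (@expiD R) (@expi0 R)). Qed.

Lemma expiMn (R : realType) (t : R) (n : nat) : expi (t * n%:R) = expi t ^+ n.
Proof.
elim: n => [|n IHn]; first by rewrite mulr0 expi0.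
by rewrite -natr1 mulrDr mulr1 expiD IHn exprSr.
Qed.

(** Up to sign the angle lies strictly between 0 and pi. This will show that exp(2 pi i n / M)
    differs from 1. *)
Lemma sin_pi_frac_neq0 (R : realType) (n : int) (M : nat) :
  n != 0 -> (`|n| < M)%N -> sin (pi * n%:~R / M%:R : R) != 0.
Proof.
have pos (k : nat) : (0 < k < M)%N -> 0 < sin (pi * k%:R / M%:R : R).
  move=> /andP[k0 kM]; apply: sin_gt0_pi.
  have M0 : (0 < M)%N by exact: leq_trans kM.
  rewrite divr_gt0 ?mulr_gt0 ?pi_gt0 ?ltr0n//=.
  by rewrite ltr_pdivrMr ?ltr0n// ltr_pM2l ?pi_gt0// ltr_nat.
case: n => p p0 pM.
  by rewrite gt_eqF// pos// pM andbT lt0n.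
rewrite NegzE mulrNz mulrN mulNr sinN oppr_eq0 gt_eqF//.
exact: (pos p.+1).
Qed.

(** For [n != 0] this is the geometric sum of an [M]-th root of unity other than 1. *)
Lemma sum_expi_frac (R : realType) (n : int) (M : nat) : (`|n| < M)%N ->
  \sum_(k < M) expi (2 * pi * n%:~R / M%:R : R) ^+ k = (n == 0)%:R * M%:R.
Proof.
move=> nM; have M0 : M%:R != 0 :> R by rewrite pnatr_eq0; case: M nM.
have [->|n0] := eqVneq n 0.
  rewrite mulr0 mul0r expi0; under eq_bigr do rewrite expr1n.
  by rewrite sumr_const card_ord mul1r.
rewrite mul0r; set z := expi _.
have zM : z ^+ M = 1.
  rewrite /z -expiMn divfK// /expi -[_ * _]addr0 cosD_2pi_int sinD_2pi_int.
  by rewrite cos0 sin0.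
have z1 : z - 1 != 0.
  rewrite subr_eq0; apply: contraNneq (sin_pi_frac_neq0 R n0 nM).
  move=> /(congr1 (@complex.Re R)) /=.
  have -> : 2 * pi * n%:~R / M%:R = (pi * n%:~R / M%:R) *+ 2 :> R by ring.
  (* If the root were 1, the double-angle formula would give cos^2 = 1 at half its angle, hence a
     vanishing sine there. *)
  rewrite cos_mulr2n => c1; rewrite -sqrf_eq0 sin2cos2.
  by apply/eqP; lra.
have := subrX1 z M; rewrite zM subrr => /esym/eqP.
by rewrite mulf_eq0 (negbTE z1) => /eqP.
Qed.

Lemma sum_grid_expi (R : realType) (d M : nat) (m : 'rV[int]_d) (a : R) :
  (forall j, (`|m ord0 j| < M)%N) ->
  \sum_(q : {ffun 'I_d -> 'I_M}) expi (phase m (grid_point R q) + a) =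
  (m == 0)%:R * (M ^ d)%:R * expi a.
Proof.
move=> mM.
pose z j := expi (2 * pi * (m ord0 j)%:~R / M%:R : R).
transitivity (\sum_(q : {ffun 'I_d -> 'I_M}) (\prod_j z j ^+ q j) * expi a).
  apply: eq_bigr => q _; rewrite expiD; congr (_ * _).
  rewrite /phase mulr_sumr expi_sum; apply: eq_bigr => j _.
  by rewrite /z -expiMn tnth_mktuple; congr expi; ring.
rewrite -mulr_suml; congr (_ * _).
(* The sum over the grid of products over coordinates is the product of one-dimensional sums. *)
rewrite -(bigA_distr_bigA (fun j (k : 'I_M) => z j ^+ k)).
under eq_bigr do rewrite sum_expi_frac//.
rewrite big_split /= prodr_const card_ord natrX; congr (_ * _).
have [->|/rV0Pn[j mj]] := eqVneq m 0.
  by apply: big1 => j _; rewrite mxE.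
by rewrite (bigD1 j)//= (negbTE mj) mul0r.
Qed.

Lemma sum_grid_cos (R : realType) (d M : nat) (m : 'rV[int]_d) (a : R) :
  (forall j, (`|m ord0 j| < M)%N) ->
  \sum_(q : {ffun 'I_d -> 'I_M}) cos (phase m (grid_point R q) + a) =
  (m == 0)%:R * (M ^ d)%:R * cos a.
Proof.
move=> mM; have := congr1 (@complex.Re R) (sum_grid_expi a mM).
rewrite raddf_sum /= => ->.
by rewrite -!natrM !mulr_natl raddfMn.
Qed.

(** * Cubature for cosines with phases in a symmetric set *)

Lemma phaseN (R : realType) (d : nat) (m : 'rV[int]_d) (x : d.-tuple R) :
  phase (- m) x = - phase m x.
Proof.
rewrite /phase -mulrN -sumrN; congr (_ * _).
by apply: eq_bigr => j _; rewrite mxE mulrNz mulNr.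
Qed.

Lemma phaseB (R : realType) (d : nat) (k l : 'rV[int]_d) (x : d.-tuple R) :
  phase (k - l) x = phase k x - phase l x.
Proof.
rewrite /phase -mulrBr -sumrB; congr (_ * _).
by apply: eq_bigr => j _; rewrite !mxE intrB mulrBl.
Qed.

Lemma int_rV_bounded (d : nat) (D : seq 'rV[int]_d) :
  exists M : nat, (0 < M)%N /\
    forall m j, m \in D -> (`|m ord0 j : int| < M)%N.
Proof.
exists (\max_(m <- D) \max_j `|m ord0 j : int|%N).+1; split=> // m j mD.
rewrite ltnS; apply: (@leq_trans (\max_j `|m ord0 j : int|%N)).
  exact: leq_bigmax.
by apply: (@leq_bigmax_seq _ D xpredT
  (fun m : 'rV[int]_d => \max_j `|m ord0 j : int|%N)).
Qed.

(* The functions cos + sin of the |D| phases m in D give only |D| real equations,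
   but the symmetry of D recovers cos and sin separately from them. *)
Lemma cubature_cos (R : realType) (d : nat) (D : {fset 'rV[int]_d}) :
  (forall m, m \in D -> - m \in D) ->
  exists (x : 'I_#|` D| -> d.-tuple R) (w : 'I_#|` D| -> R),
    [/\ forall i, torus R d (x i), forall i, 0 <= w i &
        forall m a, m \in D ->
          \sum_i w i * cos (phase m (x i) + a) = (m == 0)%:R * cos a].
Proof.
have lin (C S e : R) : C - S = e -> C + S = e -> C = e /\ S = 0.
  by move=> CS DS; split; lra.
move=> DN; have [M [M0 DM]] := int_rV_bounded D.
pose T := {ffun 'I_d -> 'I_M}.
pose q0 : T := [ffun=> Ordinal M0].
pose cas (m : 'rV[int]_d) y : R := cos (phase m y) + sin (phase m y).
pose g (q : T) : 'rV[R]_#|` D| := \row_i cas (nth 0 D i) (grid_point R q).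
(* Uniform weights on the [M ^ d] grid points. *)
have w0 (i : 'I_#|T|) : 0 <= ((M ^ d)%:R^-1 : R) by [].
(* The conic form of Caratheodory gives [|D|] points, against [|D| + 1] for the convex form; no
   equation for the total mass is imposed here. *)
have [q [w [wge0 wg]]] := conic_caratheodory q0 g (@enum_val T predT) w0.
exists (fun i => grid_point R (q i)), w; split=> //.
  by move=> i; exact: grid_point_torus.
have cas_exact m : m \in D ->
    \sum_i w i * cas m (grid_point R (q i)) = (m == 0)%:R.
  move=> mD; have mi : (index m D < #|` D|)%N by rewrite index_mem.
  have := congr1 (fun v : 'rV[R]_#|` D| => v ord0 (Ordinal mi)) wg.
  rewrite /g !summxE.
  under eq_bigr do rewrite !mxE /= nth_index//.
  under [X in _ = X -> _]eq_bigr do rewrite !mxE /= nth_index//.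
  move=> ->; rewrite -mulr_sumr.
  rewrite -(@big_enum_val _ _ _ T predT (fun q => cas m (grid_point R q))).
  rewrite big_split /=.
  (* Both parts of [cas] become shifted cosines, with shifts 0 and -pi/2, so that [sum_grid_cos]
     evaluates them. *)
  under eq_bigr do rewrite -[phase _ _]addr0.
  under [X in _ * (_ + X)]eq_bigr do rewrite -cosBpihalf.
  rewrite !sum_grid_cos; try by move=> j; exact: DM.
  rewrite cosN cos_pihalf mulr0 addr0 cos0 mulr1 mulrC mulfK//.
  by rewrite pnatr_eq0 expn_eq0 (gtn_eqF M0).
move=> m a mD.
(* With C and S the weighted sums of cosines and sines of the phase of [m], exactness at [-m] and
   [m] reads C - S = e and C + S = e with the same e; hence C = e and S = 0. *)
have := cas_exact _ mD; have := cas_exact _ (DN _ mD).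
rewrite oppr_eq0 /cas; under eq_bigr do rewrite phaseN cosN sinN mulrBr.
rewrite sumrB => casN.
under eq_bigr do rewrite mulrDr.
rewrite big_split /= => casP.
under eq_bigr do rewrite cosD mulrBr !mulrA.
rewrite sumrB -!mulr_suml.
have [-> ->] := lin _ _ _ casN casP.
by rewrite mul0r subr0.
Qed.

(** * Expansion of the squared modulus and conclusion *)

(** [P k l] and [Q k l] are the real and imaginary parts of [c k] times the conjugate of [c l]. Each
    term is the real part of that product times exp(i [phase (k - l) x]), with -sin written as a
    cosine shifted by pi/2. *)
Lemma normc_trig_sum (R : realType) (d : nat) (s : seq 'rV[int]_d)
    (c : 'rV[int]_d -> R[i]) (x : d.-tuple R) :
  let P k l := complex.Re (c k) * complex.Re (c l) +
               complex.Im (c k) * complex.Im (c l) in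
  let Q k l := complex.Im (c k) * complex.Re (c l) -
               complex.Re (c k) * complex.Im (c l) in
  Normc.normc (\sum_(k <- s) c k * fourier_char k x) ^+ 2 =
  \sum_(k <- s) \sum_(l <- s)
    (P k l * cos (phase (k - l) x + 0) + Q k l * cos (phase (k - l) x + pi / 2)).
Proof.
move=> P Q.
pose a k := complex.Re (c k); pose b k := complex.Im (c k).
pose u k : R := cos (phase k x); pose v k : R := sin (phase k x).
have normc2 (z : R[i]) :
    Normc.normc z ^+ 2 = complex.Re z * complex.Re z + complex.Im z * complex.Im z.
  by case: z => y z /=; rewrite sqr_sqrtr ?addr_ge0 ?sqr_ge0// !expr2.
rewrite normc2 !raddf_sum /= !big_distrl /= -big_split /=; apply: eq_bigr => k _.
rewrite !big_distrr /= -big_split /=; apply: eq_bigr => l _.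
rewrite addr0 cosDpihalf phaseB cosB sinB /P /Q /fourier_char.
rewrite -![2 * pi * _]/(phase _ x).
case: (c k) (c l) => [ak bk] [al bl] /=; ring.
Qed.

Theorem corollary5p1 (R : realType) (d : nat) (I : {fset 'rV[int]_d})
    (hI : I != fset0) :
  (#|` diff_set I| <= #|` I| ^ 2 - #|` I| + 1)%N /\
  exists (x : 'I_#|` diff_set I| -> d.-tuple R) (w : 'I_#|` diff_set I| -> R),
    [/\ forall i, x i \in torus R d,
        forall i, 0 <= w i,
        \sum_i w i = 1 &
        forall f : d.-tuple R -> R[i], trig_poly I f ->
          (\int[torus_measure R d]_(y in torus R d)
             ((Normc.normc (f y)) ^+ 2)%:E
           = (\sum_i w i * (Normc.normc (f (x i))) ^+ 2)%:E)%E].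
Proof.
split; first exact: card_diff_set.
have [x [w [xT w0 xw]]] := @cubature_cos R d (diff_set I) (@diff_setN d I).
exists x, w; split=> //.
- by move=> i; rewrite inE; exact: xT.
(* The weights sum to 1 by exactness at the zero frequency, where the cosine is constantly 1. *)
- have := xw _ 0 (diff_set0 hI); rewrite eqxx mul1r cos0 => <-.
  apply: eq_bigr => i _; rewrite addr0 /phase big1 ?mulr0 ?cos0 ?mulr1// => j _.
  by rewrite mxE mul0r.
move=> f [c fE].
(* Integrability is carried along because additivity of the integral, and later the restriction to
   the torus, require it. *)
pose exact_for (h : d.-tuple R -> R) :=
  (torus_measure R d).-integrable setT (EFin \o h) /\
  (\int[torus_measure R d]_y (h y)%:E = (\sum_i w i * h (x i))%:E)%E.
have exactD h1 h2 : exact_for h1 -> exact_for h2 ->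
    exact_for (fun y => h1 y + h2 y).
  move=> [i1 e1] [i2 e2]; split; first exact: (integrableD _ i1 i2).
  under eq_integral do rewrite EFinD.
  rewrite integralD// e1 e2 -EFinD -big_split /=; congr (_%:E).
  by apply: eq_bigr => i _; rewrite mulrDr.
have exactZ r h : exact_for h -> exact_for (fun y => r * h y).
  move=> [ih eh]; split; first exact: (integrableZl _ r ih).
  under eq_integral do rewrite EFinM.
  rewrite integralZl// eh -EFinM mulr_sumr; congr (_%:E).
  by apply: eq_bigr => i _; rewrite mulrCA.
have exact0 : exact_for (fun=> 0).
  split; first exact: integrable0.
  by rewrite integral0 big1// => i _; rewrite mulr0.
have exact_sum (s : seq 'rV[int]_d) (h : 'rV[int]_d -> d.-tuple R -> R) :
    (forall k, k \in s -> exact_for (h k)) ->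
    exact_for (fun y => \sum_(k <- s) h k y).
  elim: s => [_|k s IHs hs].
    by under [X in exact_for X]funext do rewrite big_nil.
  under [X in exact_for X]funext do rewrite big_cons.
  apply: exactD; first by apply: hs; rewrite mem_head.
  by apply: IHs => l ls; apply: hs; rewrite in_cons ls orbT.
have exact_cos k l a : k \in I -> l \in I ->
    exact_for (fun y => cos (phase (k - l) y + a)).
  move=> kI lI; split.
    apply: probability_bounded_integrable; last exact: bounded_cos.
    exact: measurable_cos_phase.
  rewrite integral_torus_cos xw//.
  by apply/imfset2P; exists k => //; exists l.
have [intf ef] : exact_for (fun y => Normc.normc (f y) ^+ 2).
  under [X in exact_for X]funext do rewrite fE normc_trig_sum.
  apply: (exact_sum) => k kI; apply: (exact_sum) => l lI.
  by apply: exactD; apply: exactZ; exact: exact_cos.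
by rewrite integral_over_torus.
Qed.
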